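(* Let $d\ge1$, let $m\ge n\ge 1$ be integers and $\kappa\in\mathbb R^{d+1}$ with all $\kappa_i>-1$. For $\alpha\in\mathbb Z_m^{d+1}$ define the vector $$\mathsf h_{\alpha,n}=\sqrt{\frac{m!\,(\kappa+\mathbf 1)_\alpha}{(|\kappa|+d+1)_m\,\alpha!}}\left(\frac{\mathsf H_\nu(\alpha;\kappa,m)}{\sqrt{\mathsf B_\nu(\kappa,m)}}:\ \nu\in\mathbb N_0^d,\ |\nu|=n\right)\in\mathbb R^{\mathsf r(d,n)},\qquad \mathsf r(d,n)=\binom{n+d-1}{n}.$$ Then the family $\{\mathsf h_{\alpha,n}:\alpha\in\mathbb Z_m^{d+1}\}$, which has $\binom{m+d}{d}$ members, is a tight frame in $\mathbb R^{\mathsf r(d,n)}$, that is, with $(\cdot,\cdot)$ the standard Euclidean inner product, $$(x,x)=\sum_{\alpha\in\mathbb Z_m^{d+1}}(x,\mathsf h_{\alpha,n})^2\qquad\text{for all }x\in\mathbb R^{\mathsf r(d,n)}.$$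
   Context: Notation: $(a)_n=a(a+1)\cdots(a+n-1)$, $(a)_0=1$; for vectors, $|y|$ is the sum of the components, $\alpha!=\prod_i\alpha_i!$, $(y)_\alpha=\prod_i(y_i)_{\alpha_i}$; $\mathbf 1=(1,\dots,1)$. $\mathbb Z_N^{d+1}=\{\alpha\in\mathbb N_0^{d+1}:|\alpha|=N\}$. Coordinates of $\mathbb R^{\mathsf r(d,n)}$ are indexed by $\{\nu\in\mathbb N_0^d:|\nu|=n\}$ in some fixed order. Inner product: $\langle f,g\rangle_{\mathsf H_{\kappa,N}}=\frac{N!}{(|\kappa|+d+1)_N}\sum_{x\in\mathbb Z_N^{d+1}}f(x)g(x)\frac{(\kappa+\mathbf 1)_x}{x!}$. Hahn polynomials: for $\nu\in\mathbb N_0^d$ with $|\nu|\le N$ and $x\in\mathbb Z_N^{d+1}$, put $a_j=\sum_{i=j+1}^{d+1}\kappa_i+2\sum_{i=j+1}^{d}\nu_i+d-j$ and $M_j=N-\sum_{i<j}x_i-\sum_{i=j+1}^{d}\nu_i$ for $1\le j\le d$, and $$\mathsf H_\nu(x;\kappa,N)=\frac{(-1)^{|\nu|}}{(-N)_{|\nu|}}\prod_{j=1}^d\frac{(\kappa_j+1)_{\nu_j}}{(a_j+1)_{\nu_j}}\sum_{k=0}^{\nu_j}\frac{(-\nu_j)_k(\nu_j+\kappa_j+a_j+1)_k(-x_j)_k}{(\kappa_j+1)_k\,k!}\,(-M_j+k)_{\nu_j-k}$$ (the $j$-th inner sum is $(-M_j)_{\nu_j}\,{}_3F_2(-\nu_j,\nu_j+\kappa_j+a_j+1,-x_j;\kappa_j+1,-M_j;1)$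 read as a polynomial). Let $\mathsf B_\nu(\kappa,N)=\langle\mathsf H_\nu(\cdot;\kappa,N),\mathsf H_\nu(\cdot;\kappa,N)\rangle_{\mathsf H_{\kappa,N}}>0$. In the claim these are used with $N=m$. *)

(* Defs.v *)
From HB Require Import structures.
From mathcomp Require Import all_boot all_order all_algebra.
From mathcomp Require Import reals.

Set Implicit Arguments.
Unset Strict Implicit.
Unset Printing Implicit Defensive.

Import Order.TTheory GRing.Theory Num.Theory.
Local Open Scope ring_scope.

(* {y in N_0^k : |y| = N}; since |y| = N bounds every component by N, the
   components can be taken in 'I_N.+1, which makes the type finite. *)
Definition multiindex (k N : nat) : Type :=
  {t : k.-tuple 'I_N.+1 | (\sum_(i <- t) i == N)%N}.

HB.instance Definition _ (k N : nat) :=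
  Finite.copy (multiindex k N)
    {t : k.-tuple 'I_N.+1 | (\sum_(i <- t) i == N)%N}.

Definition component (k N : nat) (y : multiindex k N) (i : 'I_k) : nat :=
  tnth (val y) i.

Coercion component : multiindex >-> Funclass.

Lemma sum_component (k N : nat) (y : multiindex k N) : (\sum_i y i = N)%N.
Proof. by rewrite -[RHS](eqP (valP y)) big_tuple. Qed.

Lemma card_multiindex (k N : nat) :
  #|{: multiindex k.+1 N}| = 'C(N + k, k).
Proof. by rewrite card_sig -cardsE card_ord_partitions addnC. Qed.

Definition frame_dim (d n : nat) : nat := 'C(n + d - 1, n).

Lemma card_multiindex_frame_dim (d n : nat) :
  (1 <= d)%N -> #|{: multiindex d n}| = frame_dim d n.
Proof.
case: d => // d _; rewrite card_multiindex /frame_dim addnS subn1 /=.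
by rewrite -[in RHS](bin_sub (leq_addr d n)) addKn.
Qed.

Section Hahn.
Variable R : realType.

Definition poch (a : R) (n : nat) : R := \prod_(i < n) (a + i%:R).

Variable d : nat.
Variable kappa : 'I_d.+1 -> R.

(* Indices are 0-based: j : 'I_d is the j+1 of the usual 1-based notation,
   whence the d - (j + 1) in hahn_a. *)
Definition hahn_a (nu : 'I_d -> nat) (j : 'I_d) : R :=
  \sum_(i < d.+1 | (j < i)%N) kappa i
  + 2 * \sum_(i < d | (j < i)%N) (nu i)%:R + (d%:R - j.+1%:R).

Definition hahn_M (N : nat) (nu : 'I_d -> nat) (x : 'I_d.+1 -> nat)
    (j : 'I_d) : R :=
  N%:R - \sum_(i < d.+1 | (i < j)%N) (x i)%:R
       - \sum_(i < d | (j < i)%N) (nu i)%:R.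

Definition hahn (N : nat) (nu : 'I_d -> nat) (x : 'I_d.+1 -> nat) : R :=
  let n := (\sum_i nu i)%N in
  (-1) ^+ n / poch (- N%:R) n *
  \prod_(j < d)
    let kj := kappa (widen_ord (leqnSn d) j) in
    let xj := x (widen_ord (leqnSn d) j) in
    let aj := hahn_a nu j in
    poch (kj + 1) (nu j) / poch (aj + 1) (nu j) *
    \sum_(k < (nu j).+1)
      poch (- (nu j)%:R) k * poch ((nu j)%:R + kj + aj + 1) k
        * poch (- xj%:R) k
      / (poch (kj + 1) k * k`!%:R)
      * poch (- hahn_M N nu x j + k%:R) (nu j - k).

(* (kappa + 1)_x / x! *)
Definition hahn_ratio (x : 'I_d.+1 -> nat) : R :=
  (\prod_i poch (kappa i + 1) (x i)) / (\prod_i (x i)`!)%:R.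

(* (|kappa| + d + 1)_N *)
Definition hahn_mass (N : nat) : R :=
  poch (\sum_i kappa i + d%:R + 1) N.

Definition hahn_ip (N : nat) (f g : multiindex d.+1 N -> R) : R :=
  N`!%:R / hahn_mass N
  * \sum_(x : multiindex d.+1 N) f x * g x * hahn_ratio x.

Definition hahn_B (N : nat) (nu : 'I_d -> nat) : R :=
  hahn_ip (fun x : multiindex d.+1 N => hahn N nu x)
          (fun x : multiindex d.+1 N => hahn N nu x).

(* e is the chosen order of the coordinates of R^(r(d,n)). *)
Definition hahn_frame (n m : nat) (e : 'I_(frame_dim d n) -> multiindex d n)
    (alpha : multiindex d.+1 m) : 'rV[R]_(frame_dim d n) :=
  Num.sqrt (m`!%:R / hahn_mass m * hahn_ratio alpha) *:
    \row_i (hahn m (e i) alpha / Num.sqrt (hahn_B m (e i))).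

End Hahn.

Definition dot (R : realType) (r : nat) (u v : 'rV[R]_r) : R :=
  \sum_i u 0 i * v 0 i.

(* Tight frame with frame constant 1. *)
Definition tight_frame (R : realType) (r : nat) (I : finType)
    (h : I -> 'rV[R]_r) : Prop :=
  forall x : 'rV[R]_r, dot x x = \sum_a dot x (h a) ^+ 2.

(* Main.v *)
(* The tight frame property is Parseval's identity for the orthonormal family
   H_nu / sqrt(B_nu), |nu| = n, so it suffices that the H_nu are pairwise
   orthogonal and nonzero.  The factor of H_nu with index 1 depends on
   x_1 alone, and the remaining factors are those of the Hahn polynomial with
   parameters (kappa_2, ..., kappa_{d+1}) on the simplex of size
   N - x_1.  Summing over x_2, ..., x_{d+1} first, induction on d leaves the
   one-variable Hahn weight with second parameter a_1 on {0, ..., N - |nu'|},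
   nu' = (nu_2, ..., nu_d).

   In one variable, the Hahn polynomial of degree n is paired with
   (x - L)(x - L + 1)...(x - L + j - 1), j <= n.  Chu-Vandermonde turns the
   pairing into the n-th finite difference of a polynomial of degree n - 1 when
   j < n, which vanishes, and of a polynomial of degree n divided by a linear
   form when j = n, which is computed by partial fractions. *)
Require Import Defs.
From mathcomp Require Import all_boot all_order all_algebra.
From mathcomp Require Import boolp reals.
From mathcomp Require Import ring lra zify.
Import Order.TTheory GRing.Theory Num.Theory.
Local Open Scope ring_scope.

(** * Pochhammer symbols *)

Lemma poch0 {R : realType} (a : R) : poch a 0 = 1.
Proof. by rewrite /poch big_ord0. Qed.

Lemma pochSr {R : realType} (a : R) n : poch a n.+1 = poch a n * (a + n%:R).
Proof. by rewrite /poch big_ord_recr. Qed.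

Lemma pochD {R : realType} (a : R) m n :
  poch a (m + n) = poch a m * poch (a + m%:R) n.
Proof.
elim: n => [|n IH]; first by rewrite addn0 poch0 mulr1.
by rewrite addnS !pochSr IH natrD addrA mulrA.
Qed.

Lemma pochS {R : realType} (a : R) n : poch a n.+1 = a * poch (a + 1) n.
Proof. by rewrite -add1n pochD pochSr poch0 mul1r addr0. Qed.

Lemma poch_gt0 {R : realType} (a : R) n : 0 < a -> 0 < poch a n.
Proof.
by move=> a0; apply: prodr_gt0 => i _; rewrite ltr_wpDr.
Qed.

Lemma poch_reflect {R : realType} (c : R) n :
  poch (1 - c - n%:R) n = (-1) ^+ n * poch c n.
Proof.
rewrite /poch (reindex_inj rev_ord_inj) -[in (-1) ^+ n](card_ord n) -prodrN.
apply: eq_bigr => i _ /=.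
by rewrite natrB // -natr1; ring.
Qed.

(** Passing to the falling factorial makes the vanishing for [x < k] available through
    [ffact_small]. *)
Lemma poch_oppn (R : realType) (x k : nat) :
  poch (- x%:R) k = (-1) ^+ k * (x ^_ k)%:R :> R.
Proof.
elim: k => [|k IH]; first by rewrite poch0 ffactn0 mulr1.
rewrite pochSr IH ffactnSr natrM exprS.
have [kx|xk] := leqP k x; first by rewrite natrB //; ring.
by rewrite ffact_small //; ring.
Qed.

(** * The one-variable weight and Chu-Vandermonde sums *)

Definition wt {R : realType} (a : R) (x : nat) : R := poch (a + 1) x / x`!%:R.

Lemma factR_neq0 (R : realType) n : n`!%:R != 0 :> R.
Proof. by rewrite pnatr_eq0 -lt0n fact_gt0. Qed.

Lemma wtS {R : realType} (a : R) x :
  x.+1%:R * wt a x.+1 = (a + 1 + x%:R) * wt a x.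
Proof.
have := factR_neq0 R x; rewrite /wt pochSr factS natrM => h.
by field; rewrite h nat1r pnatr_eq0.
Qed.

Lemma wt_gt0 {R : realType} (a : R) x : -1 < a -> 0 < wt a x.
Proof.
by move=> a1; rewrite divr_gt0 ?ltr0n ?fact_gt0 ?poch_gt0 //; lra.
Qed.

(** Chu-Vandermonde: [wt a x] is the coefficient of t^x in (1 - t)^(-a-1), and two such series are
    multiplied. The induction splits the factor [L.+1] as x + (L + 1 - x) and applies [wtS] to each
    part. *)
Lemma wt_vandermonde {R : realType} (a b : R) L :
  \sum_(x < L.+1) wt a x * wt b (L - x) = wt (a + b + 1) L.
Proof.
elim: L => [|L IH].
  by rewrite big_ord_recl big_ord0 /wt !poch0 fact0; field.
have L0 : L.+1%:R != 0 :> R by rewrite pnatr_eq0.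
apply: (mulfI L0); rewrite wtS -IH.
rewrite big_distrr /=.
transitivity (\sum_(x < L.+2) x%:R * wt a x * wt b (L.+1 - x)
  + \sum_(x < L.+2) wt a x * ((L.+1 - x)%N%:R * wt b (L.+1 - x))).
  rewrite -big_split; apply: eq_bigr => x _ /=.
  by rewrite natrB ?leq_ord //; ring.
rewrite big_ord_recl mul0r mul0r add0r [X in _ + X]big_ord_recr /=.
rewrite subnn mul0r mulr0 addr0 -big_split big_distrr /=.
apply: eq_bigr => x _; rewrite /bump /= add1n wtS.
rewrite subSS (subSn (leq_ord x)) wtS natrB ?leq_ord //; ring.
Qed.

(** The symbol (-x)_k is absorbed into the weight: the argument drops by [k] and the parameter rises
    by [k]. *)
Lemma wt_poch {R : realType} (a : R) x k :
  wt a (k + x) * poch (- (k + x)%:R) k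
  = (-1) ^+ k * poch (a + 1) k * wt (a + k%:R) x.
Proof.
rewrite poch_oppn /wt pochD -(ffact_fact (leq_addr x k)) addKn natrM.
have := factR_neq0 R x.
have : ((k + x) ^_ k)%:R != 0 :> R by rewrite pnatr_eq0 -lt0n ffact_gt0 leq_addr.
by move=> h1 h2; rewrite (addrAC a 1); field; rewrite h1 h2.
Qed.

Lemma sum_wt_poch {R : realType} (a : R) (g : nat -> R) k L :
  \sum_(x < L.+1) wt a x * poch (- x%:R) k * g x
  = if (k <= L)%N then
      (-1) ^+ k * poch (a + 1) k
        * \sum_(x < (L - k).+1) wt (a + k%:R) x * g (k + x)%N
    else 0.
Proof.
have small x : (x < k)%N -> poch (- x%:R) k = 0 :> R.
  by move=> xk; rewrite poch_oppn ffact_small // mulr0.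
case: ifP => [kL|/negbT]; last first.
  rewrite -ltnNge => Lk; apply: big1 => x _.
  by rewrite small ?mulr0 ?mul0r // (leq_trans _ Lk).
rewrite -(big_mkord xpredT (fun x => wt a x * poch (- x%:R) k * g x)).
rewrite (big_cat_nat (n := k)) //=; last exact: leqW.
rewrite big1_seq ?add0r; last first.
  by move=> x; rewrite mem_index_iota => /andP[_ xk]; rewrite small ?mulr0 ?mul0r.
rewrite -{1}[k]add0n big_addn subSn // big_mkord big_distrr /=.
by apply: eq_bigr => x _; rewrite addnC wt_poch; ring.
Qed.

(** Each Pochhammer factor is absorbed into its own weight, the second one after reversing the sum;
    Chu-Vandermonde evaluates what is left. *)
Lemma sum_wt_wt_poch {R : realType} (a b : R) k j L :
  \sum_(x < L.+1) wt a x * wt b (L - x)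
     * poch (- x%:R) k * poch (- (L - x)%N%:R) j
  = if (k + j <= L)%N then
      (-1) ^+ (k + j) * poch (a + 1) k * poch (b + 1) j
        * wt (a + b + k%:R + j%:R + 1) (L - (k + j))
    else 0.
Proof.
transitivity (\sum_(x < L.+1) wt a x * poch (- x%:R) k *
   (wt b (L - x) * poch (- (L - x)%N%:R) j)).
  by apply: eq_bigr => x _; ring.
rewrite (sum_wt_poch _ (fun x => wt b (L - x) * poch (- (L - x)%N%:R) j)).
case: (leqP k L) => [kL|Lk]; last by rewrite leqNgt (leq_trans Lk (leq_addr _ _)).
rewrite (reindex_inj rev_ord_inj) /=.
transitivity ((-1) ^+ k * poch (a + 1) k * \sum_(x < (L - k).+1)
   wt b x * poch (- x%:R) j * wt (a + k%:R) (L - k - x)).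
  congr (_ * _); apply: eq_bigr => x _; rewrite subSS.
  have -> : (L - (k + (L - k - x)) = x)%N by have := leq_ord x; lia.
  by ring.
rewrite (sum_wt_poch _ (fun x => wt (a + k%:R) (L - k - x))).
rewrite -(leq_subRL _ kL); case: ifP => jL; last by rewrite mulr0.
transitivity ((-1) ^+ (k + j) * poch (a + 1) k * poch (b + 1) j *
  \sum_(x < (L - k - j).+1) wt (b + j%:R) x
     * wt (a + k%:R) (L - k - j - x)).
  rewrite (eq_bigr (fun x : 'I_(L - k - j).+1 => wt (b + j%:R) x
    * wt (a + k%:R) (L - k - j - x))) => [|x _]; last by rewrite subnDA.
  by rewrite exprD; ring.
rewrite wt_vandermonde subnDA; congr (_ * wt _ _); ring.
Qed.

(** * The polynomials (X + c)_k as a basis *)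

Definition poch_poly {R : realType} (c : R) (k : nat) : {poly R} :=
  \prod_(i < k) ('X - (- (c + i%:R))%:P).

Lemma horner_poch_poly {R : realType} (c x : R) k :
  (poch_poly c k).[x] = poch (x + c) k.
Proof.
rewrite /poch_poly horner_prod; apply: eq_bigr => i _.
by rewrite !hornerE; ring.
Qed.

Lemma size_poch_poly {R : realType} (c : R) k : size (poch_poly c k) = k.+1.
Proof. by rewrite size_prod_XsubC -[index_enum _]enumT size_enum_ord. Qed.

Lemma monic_poch_poly {R : realType} (c : R) k : poch_poly c k \is monic.
Proof. exact: monic_prod_XsubC. Qed.

Lemma coef_poch_poly {R : realType} (c : R) k : (poch_poly c k)`_k = 1.
Proof. by have /monicP := monic_poch_poly c k; rewrite lead_coefE size_poch_poly. Qed.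

Lemma size_le_sub_lead {R : realType} (p q : {poly R}) n :
  (size p <= n.+1)%N -> size q = n.+1 -> q`_n = 1 ->
  (size (p - p`_n *: q)%R <= n)%N.
Proof.
move=> sp sq qn; apply/leq_sizeP => i ni.
rewrite coefB coefZ; move: ni; rewrite leq_eqVlt => /predU1P[<-|ni].
  by rewrite qn; ring.
by rewrite (nth_default _ (leq_trans sp ni)) [q`_i]nth_default ?sq //; ring.
Qed.

(** The (X + c)_j with [j <= n] span the polynomials of degree at most [n]. A functional that kills
    those with [j < n] sees only the leading term, which the induction strips off. *)
Lemma sum_poly_poch_poly {R : realType} (u : nat -> R) (c : R) n L :
  (forall j, (j < n)%N -> \sum_(x < L) u x * poch (x%:R + c) j = 0) ->
  forall p : {poly R}, (size p <= n.+1)%N ->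
  \sum_(x < L) u x * p.[x%:R] = p`_n * \sum_(x < L) u x * poch (x%:R + c) n.
Proof.
elim: n => [|n IH] u0 p sp.
  rewrite [p]size1_polyC // coefC big_distrr; apply: eq_bigr => x _ /=.
  by rewrite hornerC poch0; ring.
have /IH -/(_ (fun j jn => u0 j (ltnW jn))) :=
  size_le_sub_lead _ _ _ sp (size_poch_poly c n.+1) (coef_poch_poly c n.+1).
rewrite u0 // mulr0 => h.
apply/eqP; rewrite -subr_eq0 -[X in _ == X]h; apply/eqP.
rewrite big_distrr -sumrB; apply: eq_bigr => x _ /=.
by rewrite hornerD hornerN hornerZ horner_poch_poly; ring.
Qed.

(** * Finite differences *)

Lemma diffn_recl {R : realType} (f : nat -> R) n :
  \sum_(k < n.+2) (-1) ^+ k * 'C(n.+1, k)%:R * f k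
  = \sum_(k < n.+1) (-1) ^+ k * 'C(n, k)%:R * f k
    - \sum_(k < n.+1) (-1) ^+ k * 'C(n, k)%:R * f k.+1.
Proof.
rewrite big_ord_recl bin0 /=.
under eq_bigr => i _ do rewrite /bump /= add1n binS natrD.
rewrite [X in _ = X - _]big_ord_recl /= bin0 -addrA; congr (_ + _).
rewrite -sumrN.
have -> : \sum_(i < n) (-1) ^+ bump 0 i * 'C(n, bump 0 i)%:R * f (bump 0 i)
  = \sum_(i < n.+1) (-1) ^+ i.+1 * 'C(n, i.+1)%:R * f i.+1.
  rewrite big_ord_recr /= bin_small // mulr0 mul0r addr0.
  by apply: eq_bigr => i _; rewrite /bump.
rewrite -big_split; apply: eq_bigr => i _ /=; rewrite exprS; ring.
Qed.

Lemma diffn_poly {R : realType} n (p : {poly R}) : (size p <= n)%N ->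
  \sum_(k < n.+1) (-1) ^+ k * 'C(n, k)%:R * p.[k%:R] = 0.
Proof.
elim: n p => [|n IH] p sp.
  by rewrite big_ord1 (size_poly_leq0P _ sp) horner0; ring.
rewrite (diffn_recl (fun k => p.[k%:R])) -sumrB.
transitivity (\sum_(k < n.+1) (-1) ^+ k * 'C(n, k)%:R
    * (p - (p \Po ('X + 1%:P))).[k%:R]).
  apply: eq_bigr => k _.
  by rewrite hornerD hornerN horner_comp hornerD hornerX hornerC natr1; ring.
have sq : size (p \Po ('X + 1%:P)) = size p by apply: size_comp_poly2; rewrite size_XaddC.
apply: IH; apply/leq_sizeP => i ni; rewrite coefB.
(* The coefficient of index [n] is the only delicate one: if [p] has degree [n], it is the leading
   coefficient, and the shift by 1 preserves it. *)
have [->|ni'] := eqVneq i n; last first.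
  have {}ni : (n < i)%N by rewrite ltn_neqAle eq_sym ni' ni.
  have pi := leq_trans sp ni; by rewrite !nth_default ?subr0 ?sq.
move: sp; rewrite leq_eqVlt => /predU1P[sp|sp]; last first.
  by rewrite !nth_default ?subr0 ?sq.
have := lead_coef_comp p (q := 'X + 1%:P); rewrite size_XaddC => /(_ isT).
by rewrite lead_coefXaddC expr1n mulr1 !lead_coefE sq sp /= => ->; rewrite subrr.
Qed.

(** The partial fraction decomposition of n!/(y)_(n+1). By [diffn_recl] the step is a difference of
    the instances at [y] and [y + 1]. *)
Lemma diffn_inv {R : realType} n (y : R) : 0 < y ->
  \sum_(k < n.+1) (-1) ^+ k * 'C(n, k)%:R * (y + k%:R)^-1
  = n`!%:R / poch y n.+1.
Proof.
elim: n y => [|n IH] y y0.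
  by rewrite big_ord1 pochSr poch0 bin0 fact0 addr0 expr0 !mul1r.
rewrite (diffn_recl (fun k => (y + k%:R)^-1)) IH //.
transitivity (n`!%:R / poch y n.+1 - n`!%:R / poch (y + 1) n.+1).
  congr (_ - _); rewrite -IH; last lra.
  by apply: eq_bigr => k _; rewrite -nat1r addrA.
have h1 := poch_gt0 (y + 1) n ltac:(lra).
have n0 := ler0n R n.
rewrite (pochS y n.+1) (pochS y n) (pochSr (y + 1) n) factS natrM -natr1.
by field; rewrite !gt_eqF //; lra.
Qed.

(* Write [p = p.[-y] + (X + y) q]: the second part is killed because
   [size q <= n]. *)
Lemma diffn_poly_div {R : realType} n (p : {poly R}) (y : R) :
  0 < y -> (size p <= n.+1)%N ->
  \sum_(k < n.+1) (-1) ^+ k * 'C(n, k)%:R * (p.[k%:R] / (y + k%:R))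
  = p.[- y] * n`!%:R / poch y n.+1.
Proof.
move=> y0 sp.
have /factor_theorem[q qE] : root (p - (p.[- y])%:P) (- y).
  by rewrite /root !hornerE subrr.
have sq : (size q <= n)%N.
  have [->|q0] := eqVneq q 0; first by rewrite size_poly0.
  rewrite -ltnS; have := size_Mmonic q0 (monicXsubC (- y)).
  rewrite size_XsubC addn2 /= => <-; rewrite -qE.
  by rewrite (leq_trans (size_polyD _ _)) // geq_max sp size_polyN
    (leq_trans (size_polyC_leq1 _)).
transitivity (p.[- y] * (\sum_(k < n.+1) (-1) ^+ k * 'C(n, k)%:R * (y + k%:R)^-1)
   + \sum_(k < n.+1) (-1) ^+ k * 'C(n, k)%:R * q.[k%:R]).
  rewrite big_distrr -big_split; apply: eq_bigr => k _ /=.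
  have -> : p.[k%:R] = p.[- y] + q.[k%:R] * (y + k%:R).
    have := congr1 (horner^~ k%:R) qE; rewrite !hornerE opprK => h.
    by rewrite (addrC y) -h; ring.
  have := ler0n R k => k0.
  by field; rewrite gt_eqF //; lra.
by rewrite diffn_inv // diffn_poly // addr0 mulrA.
Qed.

(** * Hahn polynomials in one variable *)

Definition hahn1_coef {R : realType} (n : nat) (a b M : R) (k : nat) : R :=
  poch (- n%:R) k * poch (n%:R + a + b + 1) k / (poch (a + 1) k * k`!%:R)
  * poch (- M + k%:R) (n - k).

(* [(-M)_n 3F2(-n, n+a+b+1, -x; a+1, -M; 1)] read as a polynomial. *)
Definition hahn1 {R : realType} (n : nat) (a b M x : R) : R :=
  \sum_(k < n.+1) hahn1_coef n a b M k * poch (- x) k.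

(** The form of the right-hand side is chosen to exhibit the sign and binomial of an [n]-th
    difference in [k]; the factor in front is free of [k]. If [k + j > L], both sides vanish because
    (k - L)_j does. *)
Lemma sum_hahn1_poch_term {R : realType} (a b : R) n L j k :
  -1 < a -> -1 < b -> (k <= n <= L)%N ->
  hahn1_coef n a b L%:R k *
  \sum_(x < L.+1) wt a x * wt b (L - x)
     * poch (- x%:R) k * poch (- (L - x)%N%:R) j
  = (-1) ^+ n * poch (b + 1) j * poch (a + b + 2) L / (L - n)`!%:R *
   ((-1) ^+ k * 'C(n, k)%:R * ((poch_poly (- L%:R) j).[k%:R] *
     (poch (n%:R + (a + b + 1)) k / poch (a + b + 2) (k + j)))).
Proof.
move=> a1 b1 /andP[kn nL]; have kL := leq_trans kn nL.
rewrite sum_wt_wt_poch horner_poch_poly.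
have -> : k%:R + - L%:R = - (L - k)%:R :> R by rewrite natrB //; ring.
rewrite [poch (- (L - k)%:R) j]poch_oppn.
case: ifP => [kjL|/negbT]; last first.
  by rewrite -ltnNge => Lkj; rewrite ffact_small ?ltn_subLR //; ring.
rewrite /hahn1_coef.
have -> : - L%:R + k%:R = - (L - k)%:R :> R by rewrite natrB //; ring.
rewrite !poch_oppn -(bin_ffact n k) natrM /wt.
(* Both products are (L - k)!. *)
have e1 : ((L - k) ^_ (n - k))%:R * (L - n)`!%:R
  = ((L - k) ^_ j)%:R * (L - (k + j))`!%:R :> R.
  rewrite -!natrM subnDA ffact_fact ?leq_subRL //.
  by rewrite -(ffact_fact (leq_sub2r k nL)); congr (_ * _`!)%:R; lia.
have -> : poch (a + b + 2) L
  = poch (a + b + 2) (k + j) * poch (a + b + 2 + (k + j)%:R) (L - (k + j)).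
  by rewrite -pochD subnKC.
have -> : (-1) ^+ n = (-1) ^+ k * (-1) ^+ (n - k) :> R by rewrite -exprD subnKC.
have -> : ((L - k) ^_ (n - k))%:R
  = ((L - k) ^_ j)%:R * (L - (k + j))`!%:R / (L - n)`!%:R :> R.
  by rewrite -e1 mulfK // factR_neq0.
have -> : a + b + k%:R + j%:R + 1 + 1 = a + b + 2 + (k + j)%:R.
  by rewrite natrD; ring.
have -> : n%:R + a + b + 1 = n%:R + (a + b + 1) by ring.
have h1 := factR_neq0 R k.
have h2 := factR_neq0 R (L - n).
have h3 := factR_neq0 R (L - (k + j)).
have h4 : poch (a + 1) k != 0 by rewrite gt_eqF // poch_gt0 //; lra.
have h5 : poch (a + b + 2) (k + j) != 0 by rewrite gt_eqF // poch_gt0 //; lra.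
by rewrite exprD; field; rewrite h1 h2 h3 h4 h5.
Qed.

Lemma sum_hahn1_poch {R : realType} (a b : R) n L j :
  -1 < a -> -1 < b -> (n <= L)%N ->
  \sum_(x < L.+1) wt a x * wt b (L - x) * hahn1 n a b L%:R x%:R
     * poch (x%:R + - L%:R) j
  = (-1) ^+ n * poch (b + 1) j * poch (a + b + 2) L / (L - n)`!%:R *
   \sum_(k < n.+1) (-1) ^+ k * 'C(n, k)%:R * ((poch_poly (- L%:R) j).[k%:R] *
     (poch (n%:R + (a + b + 1)) k / poch (a + b + 2) (k + j))).
Proof.
move=> a1 b1 nL; rewrite [RHS]big_distrr /=.
transitivity (\sum_(k < n.+1) hahn1_coef n a b L%:R k *
  \sum_(x < L.+1) wt a x * wt b (L - x)
     * poch (- x%:R) k * poch (- (L - x)%N%:R) j).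
  under [RHS]eq_bigr => k _ do rewrite big_distrr /=.
  rewrite exchange_big; apply: eq_bigr => x _ /=.
  have -> : x%:R + - L%:R = - (L - x)%:R :> R.
    by rewrite natrB ?leq_ord //; ring.
  rewrite /hahn1 big_distrr big_distrl; apply: eq_bigr => k _ /=; ring.
by apply: eq_bigr => k _; rewrite sum_hahn1_poch_term // leq_ord.
Qed.

Lemma poch_ratio {R : realType} (s : R) n k :
  0 < s + 1 -> poch (n.+1%:R + s) k * poch (s + 1) n = poch (s + 1) (n + k).
Proof. by move=> s0; rewrite pochD mulrC -natr1; congr (_ * poch _ _); ring. Qed.

(** For [j < n] the quotient of Pochhammer symbols is, up to a constant, a polynomial in [k] of
    degree n - 1 - j. Together with (k - L)_j it has degree n - 1, which the [n]-th difference
    kills. *)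
Lemma sum_hahn1_poch_lt {R : realType} (a b : R) n L j :
  -1 < a -> -1 < b -> (j < n <= L)%N ->
  \sum_(x < L.+1) wt a x * wt b (L - x) * hahn1 n a b L%:R x%:R
     * poch (x%:R + - L%:R) j = 0.
Proof.
move=> a1 b1 /andP[jn nL]; rewrite sum_hahn1_poch //.
case: n jn nL => // n jn nL.
rewrite ltnS in jn.
set s := a + b + 1; have -> : a + b + 2 = s + 1 by rewrite /s; ring.
have s0 : 0 < s + 1 by rewrite /s; lra.
pose p := poch_poly (- L%:R) j * poch_poly (s + 1 + j%:R) (n - j).
transitivity ((-1) ^+ n.+1 * poch (b + 1) j * poch (s + 1) L / (L - n.+1)`!%:R
  / poch (s + 1) n * \sum_(k < n.+2) (-1) ^+ k * 'C(n.+1, k)%:R * p.[k%:R]).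
  rewrite -[in RHS]mulrA; congr (_ * _); rewrite big_distrr; apply: eq_bigr => k _ /=.
  rewrite hornerM (horner_poch_poly (s + 1 + _)).
  have h0 := poch_gt0 (s + 1) n s0.
  have h1 := poch_gt0 (s + 1) (k + j) s0.
  have -> : poch (n.+1%:R + s) k = poch (s + 1) (n + k) / poch (s + 1) n.
    by rewrite -poch_ratio // mulfK // gt_eqF.
  have -> : (n + k = (k + j) + (n - j))%N by lia.
  rewrite pochD.
  have -> : s + 1 + (k + j)%:R = k%:R + (s + 1 + j%:R) by rewrite natrD; ring.
  by field; rewrite !gt_eqF // .
rewrite diffn_poly ?mulr0 //.
rewrite (leq_trans (size_polyMleq _ _)) // !size_poch_poly addSn /=; lia.
Qed.

(** For [j = n] the quotient of Pochhammer symbols retains one linear denominator in [k], so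
    [diffn_poly_div] evaluates (X - L)_n at its root. *)
Lemma sum_hahn1_poch_eq {R : realType} (a b : R) n L :
  -1 < a -> -1 < b -> (n <= L)%N ->
  \sum_(x < L.+1) wt a x * wt b (L - x) * hahn1 n a b L%:R x%:R
     * poch (x%:R + - L%:R) n
  = poch (b + 1) n * n`!%:R * wt (a + b + 1 + 2 * n%:R) (L - n).
Proof.
move=> a1 b1 nL; rewrite sum_hahn1_poch //.
set s := a + b + 1; have -> : a + b + 2 = s + 1 by rewrite /s; ring.
have s0 : 0 < s + 1 by rewrite /s; lra.
(* Degree 0 is separate: there [y] would be [s], which is only known to exceed -1. *)
case: n nL => [|n] nL.
  rewrite big_ord1 subn0 fact0 horner_poch_poly !poch0 bin0 /wt mulr0 addr0.
  by field; rewrite factR_neq0.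
pose y : R := s + n.+1%:R.
have n0 := ler0n R n.
have y0 : 0 < y by rewrite /y -natr1; lra.
have h0 := poch_gt0 (s + 1) n s0.
transitivity ((-1) ^+ n.+1 * poch (b + 1) n.+1 * poch (s + 1) L / (L - n.+1)`!%:R
  / poch (s + 1) n * \sum_(k < n.+2) (-1) ^+ k * 'C(n.+1, k)%:R *
     ((poch_poly (- L%:R) n.+1).[k%:R] / (y + k%:R))).
  rewrite -[in RHS]mulrA; congr (_ * _); rewrite big_distrr; apply: eq_bigr => k _ /=.
  have h1 := poch_gt0 (s + 1) (n + k) s0.
  have k0 := ler0n R k.
  have -> : poch (n.+1%:R + s) k = poch (s + 1) (n + k) / poch (s + 1) n.
    by rewrite -poch_ratio // mulfK // gt_eqF.
  have -> : (k + n.+1 = (n + k).+1)%N by lia.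
  rewrite pochSr.
  have -> : s + 1 + (n + k)%:R = y + k%:R by rewrite natrD /y -natr1; ring.
  by field; rewrite !gt_eqF //; lra.
rewrite diffn_poly_div ?size_poch_poly // horner_poch_poly.
have -> : - y + - L%:R = 1 - (s + 1 + L%:R) - n.+1%:R by rewrite /y; ring.
rewrite poch_reflect.
(* Multiplied by (s + 1)_L, both sides become (s + 1)_(L+n+1). *)
have -> : poch (s + 1 + L%:R) n.+1
  = poch (s + 1) (n.+1 + n.+1) * poch (s + 2 * n.+1%:R + 1) (L - n.+1)
    / poch (s + 1) L.
  have h2 := poch_gt0 (s + 1) L s0.
  apply: (mulIf (lt0r_neq0 h2)); rewrite divfK ?gt_eqF // mulrC -pochD.
  have -> : s + 2 * n.+1%:R + 1 = s + 1 + (n.+1 + n.+1)%:R by rewrite natrD; ring.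
  by rewrite -pochD; congr poch; lia.
have -> : poch (s + 1) (n.+1 + n.+1) = poch (s + 1) n * poch y n.+2.
  have -> : y = s + 1 + n%:R by rewrite /y -natr1; ring.
  by rewrite -pochD; congr poch; lia.
rewrite /wt.
have h2 := poch_gt0 (s + 1) L s0.
have h3 := poch_gt0 y n.+2 y0.
have h4 : 0 < (L - n.+1)`!%:R :> R by rewrite ltr0n fact_gt0.
have h5 : (-1) ^+ n.+1 * (-1) ^+ n.+1 = 1 :> R by rewrite -expr2 sqrr_sign.
rewrite -[RHS]mul1r -[X in _ = X * _]h5.
by field; rewrite !gt_eqF.
Qed.

(** [hahn1] as a polynomial in x, through (-x)_k = (-1)^k (x - k + 1)_k. *)
Definition hahn1_poly {R : realType} (n : nat) (a b M : R) : {poly R} :=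
  \sum_(k < n.+1) (hahn1_coef n a b M k * (-1) ^+ k) *: poch_poly (1 - k%:R) k.

Lemma horner_hahn1_poly {R : realType} n (a b M x : R) :
  (hahn1_poly n a b M).[x] = hahn1 n a b M x.
Proof.
rewrite horner_sum; apply: eq_bigr => k _.
rewrite hornerZ horner_poch_poly -mulrA -poch_reflect; congr (_ * poch _ _); ring.
Qed.

Lemma size_hahn1_poly {R : realType} n (a b M : R) : (size (hahn1_poly n a b M) <= n.+1)%N.
Proof.
apply: (leq_trans (size_sum _ _ _)); apply/bigmax_leqP => k _.
rewrite (leq_trans (size_scale_leq _ _)) //.
by rewrite size_poch_poly.
Qed.

Lemma lead_hahn1_poly {R : realType} n (a b M : R) : -1 < a ->
  (hahn1_poly n a b M)`_n = poch (n%:R + a + b + 1) n / poch (a + 1) n.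
Proof.
move=> a1; rewrite coef_sum (bigD1 ord_max) //= big1 => [|k nk].
  rewrite addr0 coefZ coef_poch_poly mulr1 /hahn1_coef subnn poch0 poch_oppn ffactnn.
  have h5 : (-1) ^+ n * (-1) ^+ n = 1 :> R by rewrite -expr2 sqrr_sign.
  have h : poch (a + 1) n != 0 by rewrite gt_eqF // poch_gt0 //; lra.
  rewrite -[RHS]mul1r -[X in _ = X * _]h5; field; rewrite h factR_neq0 //.
rewrite coefZ nth_default ?mulr0 // size_poch_poly.
by rewrite ltn_neqAle -ltnS ltn_ord andbT; apply: contra nk => /eqP kn; apply/eqP/val_inj.
Qed.

(** In each term either (-x)_k or (k - L)_(n-k) contains a zero factor. This covers degrees above
    [L], which occur once the first component of a multi-index is compared with a shrunken
    simplex. *)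
Lemma hahn1_eq0 {R : realType} n (a b : R) L x : (L < n)%N -> (x <= L)%N ->
  hahn1 n a b L%:R x%:R = 0.
Proof.
move=> Ln xL; apply: big1 => k _; rewrite /hahn1_coef.
have [kx|xk] := leqP k x; last by rewrite (poch_oppn _ x) ffact_small // !mulr0.
have -> : - L%:R + k%:R = - (L - k)%:R :> R.
  by rewrite natrB ?(leq_trans kx) //; ring.
rewrite (poch_oppn _ (L - k)) ffact_small ?mulr0 ?mul0r //.
by have := leq_trans kx xL; lia.
Qed.

(** The leading coefficient of the polynomial times the constant of [sum_hahn1_poch_eq]. *)
Definition hahn1_norm {R : realType} (n : nat) (a b : R) : R :=
  n`!%:R * poch (b + 1) n * poch (n%:R + a + b + 1) n / poch (a + 1) n.

Lemma hahn1_norm_gt0 {R : realType} n (a b : R) :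
  -1 < a -> -1 < b -> 0 < hahn1_norm n a b.
Proof.
move=> a1 b1; have a0 := poch_gt0 (a + 1) n ltac:(lra).
have b0 := poch_gt0 (b + 1) n ltac:(lra).
rewrite divr_gt0 // mulr_gt0 //; first by rewrite mulr_gt0 // ltr0n fact_gt0.
(* For [n = 0] the base [a + b + 1] may be nonpositive, but the symbol is empty. *)
case: n {a0 b0} => [|n]; first by rewrite poch0.
by apply: poch_gt0; rewrite -natr1; have := ler0n R n; lra.
Qed.

(** By symmetry [n' <= n]; expanding the second polynomial in the (x - L)_j leaves only [j = n]. The
    value depends on [L] through a weight [wt] alone, which lets it serve as the weight of a further
    one-variable sum. *)
Lemma hahn1_orthogonal {R : realType} (a b : R) n n' L :
  -1 < a -> -1 < b ->
  \sum_(x < L.+1) wt a x * wt b (L - x)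
    * hahn1 n a b L%:R x%:R * hahn1 n' a b L%:R x%:R
  = if (n == n') && (n <= L)%N then
      hahn1_norm n a b * wt (a + b + 1 + 2 * n%:R) (L - n)
    else 0.
Proof.
move=> a1 b1; wlog le_n : n n' / (n' <= n)%N => [hw|].
  have [/hw //|/ltnW /hw h] := leqP n' n.
  rewrite -(eq_sym n'); case: eqP h => [<- -> //|_ /= h].
  by rewrite -[RHS]h; apply: eq_bigr => x _; ring.
have [nL|Ln] := leqP n L; last first.
  rewrite andbF; apply: big1 => x _.
  by rewrite hahn1_eq0 ?leq_ord //; ring.
under eq_bigr => x _ do rewrite -(horner_hahn1_poly n').
rewrite andbT (sum_poly_poch_poly (fun x => wt a x * wt b (L - x)
    * hahn1 n a b L%:R x%:R) (- L%:R) n); last 2 first.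
- by move=> j jn; apply: sum_hahn1_poch_lt; rewrite ?jn.
- by rewrite (leq_trans (size_hahn1_poly _ _ _ _)).
rewrite sum_hahn1_poch_eq //; case: eqP => [<-|nn'].
  by rewrite lead_hahn1_poly // /hahn1_norm; ring.
rewrite nth_default ?mul0r // (leq_trans (size_hahn1_poly _ _ _ _)) //.
by rewrite ltn_neqAle le_n andbT eq_sym; apply/eqP.
Qed.

(** * Sums over the discrete simplex *)

Definition fcons {k : nat} (x : nat) (y : 'I_k -> nat) (i : 'I_k.+1) : nat :=
  if unlift ord0 i is Some j then y j else x.

Lemma fcons0 k x (y : 'I_k -> nat) : fcons x y ord0 = x.
Proof. by rewrite /fcons unlift_none. Qed.

Lemma fcons_lift k x (y : 'I_k -> nat) j : fcons x y (lift ord0 j) = y j.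
Proof. by rewrite /fcons liftK. Qed.

(* The bound [B] on the components is independent of [N], so that fixing one
   component changes [N] but not the type of the summation index. *)
Definition simplex_sum {R : realType} (B k N : nat) (F : ('I_k -> nat) -> R) : R :=
  \sum_(t : k.-tuple 'I_B.+1 | (\sum_(i <- t) i == N)%N)
     F (fun i => tnth t i).
Arguments simplex_sum {R} B k N F.

Lemma simplex_sum0 {R : realType} B N (F : ('I_0 -> nat) -> R) (y : 'I_0 -> nat) :
  simplex_sum B 0 N F = if N == 0 then F y else 0.
Proof.
rewrite /simplex_sum; case: ifP => N0.
  rewrite (big_pred1 [tuple]) => [|t /=]; last first.
    by rewrite (tuple0 t) big_nil eq_sym N0; apply/esym/eqP.
  by congr F; apply/funext => -[].
by rewrite big_pred0 // => t; rewrite (tuple0 t) big_nil eq_sym.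
Qed.

Lemma simplex_sumS {R : realType} B k N (F : ('I_k.+1 -> nat) -> R) : (N <= B)%N ->
  simplex_sum B k.+1 N F
  = \sum_(x < N.+1) simplex_sum B k (N - x) (fun y => F (fcons x y)).
Proof.
move=> NB; rewrite /simplex_sum.
rewrite (reindex (fun p : 'I_B.+1 * k.-tuple 'I_B.+1 => cons_tuple p.1 p.2)) /=; last first.
  exists (fun t => (thead t, [tuple of behead t])) => [[x t]|t] _ /=.
    by congr pair; apply/val_inj.
  by rewrite [RHS]tuple_eta; apply/val_inj.
(* The guard is needed because [N - x] truncates to 0 for [x > N]. *)
transitivity (\sum_(x < B.+1 | (x < N.+1)%N)
  \sum_(t : k.-tuple 'I_B.+1 | (\sum_(i <- t) i == N - x)%N)
     F (fcons x (fun i => tnth t i))).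
  rewrite pair_big_dep; apply: eq_big => [[x t]|[x t] _] /=.
    by rewrite big_cons ltnS; lia.
  congr F; apply/funext => i; case: (unliftP ord0 i) => [j|] ->.
    by rewrite fcons_lift (tnth_nth ord0) [in RHS](tnth_nth ord0).
  by rewrite fcons0 (tnth_nth ord0).
by rewrite [RHS](big_ord_widen B.+1 (fun x =>
  \sum_(t : k.-tuple 'I_B.+1 | (\sum_(i <- t) i == N - x)%N)
     F (fcons x (fun i => tnth t i)))).
Qed.

Lemma simplex_sum_multiindex {R : realType} k N (F : ('I_k -> nat) -> R) :
  \sum_(x : multiindex k N) F x = simplex_sum N k N F.
Proof.
rewrite /simplex_sum (reindex_omap (val : multiindex k N -> _) insub) => [|t Pt].
  by apply: eq_bigl => x; rewrite (valP x) valK eqxx.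
by rewrite insubT.
Qed.

(** * Splitting off the first variable of a multivariate Hahn polynomial *)

Definition hahn_prod {R : realType} d (kappa : 'I_d.+1 -> R) (N : nat)
    (nu : 'I_d -> nat) (x : 'I_d.+1 -> nat) : R :=
  \prod_(j < d) hahn1 (nu j) (kappa (widen_ord (leqnSn d) j))
    (hahn_a kappa nu j) (hahn_M R N nu x j)
    (x (widen_ord (leqnSn d) j))%:R.
Arguments hahn_prod {R d} kappa N nu x.

Definition hahn_const {R : realType} d (kappa : 'I_d.+1 -> R) (N : nat)
    (nu : 'I_d -> nat) : R :=
  (-1) ^+ (\sum_i nu i)%N / poch (- N%:R) (\sum_i nu i)%N *
  \prod_(j < d) (poch (kappa (widen_ord (leqnSn d) j) + 1) (nu j)
    / poch (hahn_a kappa nu j + 1) (nu j)).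
Arguments hahn_const {R d} kappa N nu.

Lemma hahnE {R : realType} d (kappa : 'I_d.+1 -> R) N nu x :
  hahn kappa N nu x = hahn_const kappa N nu * hahn_prod kappa N nu x.
Proof.
rewrite /hahn /hahn_const /hahn_prod -[RHS]mulrA -big_split; congr (_ * _).
apply: eq_bigr => j _; congr (_ * _); apply: eq_bigr => k _.
by rewrite /hahn1_coef; ring.
Qed.

Lemma hahn_ratioE {R : realType} d (kappa : 'I_d.+1 -> R) x :
  hahn_ratio kappa x = \prod_i wt (kappa i) (x i).
Proof. by rewrite /hahn_ratio natr_prod -prodf_div. Qed.

(** This is the weight parameter that summation over the remaining variables produces; it depends on
    them only through |nu'|. *)
Lemma hahn_a0 {R : realType} d (kappa : 'I_d.+2 -> R) (nu : 'I_d.+1 -> nat) :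
  hahn_a kappa nu ord0 = \sum_i kappa (lift ord0 i) + d%:R
    + 2 * (\sum_i nu (lift ord0 i))%:R.
Proof.
rewrite /hahn_a natr_sum big_mkcond big_ord_recl /= add0r.
by rewrite [X in 2 * X]big_mkcond [X in 2 * X]big_ord_recl /= add0r -natr1; ring.
Qed.

Lemma hahn_a_lift {R : realType} d (kappa : 'I_d.+2 -> R) (nu : 'I_d.+1 -> nat) j :
  hahn_a kappa nu (lift ord0 j)
  = hahn_a (fun i => kappa (lift ord0 i)) (fun i => nu (lift ord0 i)) j.
Proof.
rewrite /hahn_a big_mkcond big_ord_recl /= add0r -big_mkcond /=.
rewrite [X in 2 * X]big_mkcond [X in 2 * X]big_ord_recl /= add0r -big_mkcond /=.
congr (_ + 2 * _ + _).
by rewrite /bump add1n -[d.+1%:R]natr1 -[j.+2%:R]natr1; ring.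
Qed.

Lemma hahn_M0 {R : realType} d N (nu : 'I_d.+1 -> nat) x :
  hahn_M R N nu x ord0 = N%:R - (\sum_i nu (lift ord0 i))%:R.
Proof.
rewrite /hahn_M natr_sum big1 // subr0.
by rewrite big_mkcond big_ord_recl /= add0r.
Qed.

Lemma hahn_M_lift {R : realType} d N (nu : 'I_d.+1 -> nat) x y j : (x <= N)%N ->
  hahn_M R N nu (fcons x y) (lift ord0 j)
  = hahn_M R (N - x) (fun i => nu (lift ord0 i)) y j.
Proof.
move=> xN; rewrite /hahn_M big_mkcond big_ord_recl /= fcons0 -big_mkcond /=.
rewrite [X in _ - X]big_mkcond [X in _ - X]big_ord_recl /= add0r -big_mkcond /=.
rewrite natrB // opprD addrA.
by under eq_bigr => i _ do rewrite fcons_lift.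
Qed.

Lemma hahn_prodS {R : realType} d (kappa : 'I_d.+2 -> R) N (nu : 'I_d.+1 -> nat) x y :
  (x <= N)%N ->
  hahn_prod kappa N nu (fcons x y)
  = hahn1 (nu ord0) (kappa ord0) (hahn_a kappa nu ord0)
      (N%:R - (\sum_i nu (lift ord0 i))%:R) x%:R
    * hahn_prod (fun i => kappa (lift ord0 i)) (N - x)
        (fun i => nu (lift ord0 i)) y.
Proof.
move=> xN; rewrite /hahn_prod big_ord_recl hahn_M0.
have -> : widen_ord (leqnSn d.+1) ord0 = ord0 by exact: val_inj.
rewrite fcons0; congr (_ * _); apply: eq_bigr => j _.
have -> : widen_ord (leqnSn d.+1) (lift ord0 j) = lift ord0 (widen_ord (leqnSn d) j).
  exact: val_inj.
by rewrite fcons_lift hahn_a_lift hahn_M_lift.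
Qed.

(** * Orthogonality in several variables *)

Lemma sum_param_gt {R : realType} d (kappa : 'I_d.+1 -> R) :
  (forall i, -1 < kappa i) -> -1 < \sum_i kappa i + d%:R.
Proof.
move=> k1; have : 0 < \sum_i (kappa i + 1).
  rewrite big_ord_recl ltr_wpDr ?sumr_ge0 //; first move=> i _.
    by have := k1 (lift ord0 i); lra.
  by have := k1 ord0; lra.
by rewrite big_split /= sumr_const card_ord -[d.+1%:R]natr1; lra.
Qed.

Lemma hahn_a_gt {R : realType} d (kappa : 'I_d.+1 -> R) (nu : 'I_d -> nat) j :
  (forall i, -1 < kappa i) -> -1 < hahn_a kappa nu j.
Proof.
elim: d kappa nu j => [|d IH] kappa nu j k1; first by case: j.
case: (unliftP ord0 j) => [i|] ->; first by rewrite hahn_a_lift; exact: IH.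
rewrite hahn_a0; have := sum_param_gt d (fun i => kappa (lift ord0 i)) (fun i => k1 _).
by have := ler0n R (\sum_i nu (lift ord0 i)); lra.
Qed.

(** [C] is chosen before [mu] and [N], since the induction hypothesis is used at every size [N - x]
    with the same constant. The inner sum then supplies the second weight for [hahn1_orthogonal]. *)
Lemma simplex_sum_hahn_prod {R : realType} B d (kappa : 'I_d.+1 -> R) (nu : 'I_d -> nat) :
  (forall i, -1 < kappa i) ->
  exists2 C : R, 0 < C & forall (mu : 'I_d -> nat) N, (N <= B)%N ->
  simplex_sum B d.+1 N (fun x => (\prod_i wt (kappa i) (x i))
     * hahn_prod kappa N nu x * hahn_prod kappa N mu x)
  = if [forall j, nu j == mu j] && (\sum_i nu i <= N)%N then
      C * wt (\sum_i kappa i + d%:R + 2 * (\sum_i nu i)%:R) (N - \sum_i nu i)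
    else 0.
Proof.
elim: d kappa nu => [|d IH] kappa nu k1.
  (* The leftover simplex has no coordinates and is empty unless its size is 0, so only [x = N]
     contributes. *)
  exists 1 => // mu N NB; rewrite simplex_sumS // big_ord_recr /= subnn.
  rewrite (simplex_sum0 _ _ _ (fun=> 0%N)) eqxx big1 ?add0r => [|x _]; last first.
    by rewrite (simplex_sum0 _ _ _ (fun=> 0%N)) subn_eq0 leqNgt ltn_ord.
  rewrite /hahn_prod !big_ord0 !big_ord1 fcons0 subn0 mulr0 !addr0 mulr1 mulr1 mul1r.
  by case: forallP => // -[] [].
pose kappa' i := kappa (lift ord0 i); pose nu' i := nu (lift ord0 i).
have k1' i : -1 < kappa' i by exact: k1.
have [C C0 CE] := IH kappa' nu' k1'.
set a := hahn_a kappa nu ord0; set S := (\sum_i nu' i)%N.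
have aE : a = \sum_i kappa' i + d%:R + 2 * S%:R by rewrite /a hahn_a0.
have a1 : -1 < a by exact: hahn_a_gt.
exists (C * hahn1_norm (nu ord0) (kappa ord0) a).
  by rewrite mulr_gt0 ?hahn1_norm_gt0.
move=> mu N NB; rewrite simplex_sumS //.
pose mu' i := mu (lift ord0 i).
have step (x : 'I_N.+1) : simplex_sum B d.+1 (N - x) (fun y =>
     (\prod_i wt (kappa i) (fcons x y i))
     * hahn_prod kappa N nu (fcons x y) * hahn_prod kappa N mu (fcons x y))
  = wt (kappa ord0) x * hahn1 (nu ord0) (kappa ord0) a (N%:R - S%:R) x%:R
    * hahn1 (mu ord0) (kappa ord0) (hahn_a kappa mu ord0)
        (N%:R - (\sum_i mu' i)%:R) x%:R
    * (if [forall j, nu' j == mu' j] && (S <= N - x)%N then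
         C * wt a (N - x - S) else 0).
  (* The induction hypothesis is read backwards, so that both sides become simplex sums compared
     term by term. *)
  rewrite aE -CE; last exact: leq_trans (leq_subr _ _) NB.
  rewrite /simplex_sum big_distrr; apply: eq_bigr => t _ /=.
  rewrite !hahn_prodS ?leq_ord // big_ord_recl fcons0 -/a -aE.
  rewrite (_ : \prod_(i < d.+1) _ = \prod_i wt (kappa' i) (tnth t i)); last first.
    by apply: eq_bigr => i _; rewrite fcons_lift.
  rewrite -/nu' -/mu' -/kappa' -/S.
  by ring.
rewrite (eq_bigr _ (fun x _ => step x)).
have -> : [forall j, nu j == mu j] = (nu ord0 == mu ord0) && [forall j, nu' j == mu' j].
  apply/forallP/andP => [h|[h0 /forallP h] j]; first split=> //.
    by apply/forallP => i; exact: h.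
  by case: (unliftP ord0 j) => [i|] ->; [exact: h | exact: h0].
case: forallP => [numu|_]; last first.
  by rewrite andbF big1 // => x _; rewrite mulr0.
have munu : (\sum_i mu' i = S)%N by apply: eq_bigr => i _; rewrite (eqP (numu i)).
(* Since |mu'| = |nu'|, both first factors now belong to the same one-variable family. *)
have -> : hahn_a kappa mu ord0 = a by rewrite aE hahn_a0 -/mu' munu.
have nuE : (\sum_i nu i = nu ord0 + S)%N by rewrite big_ord_recl.
rewrite munu andbT nuE.
have [SN|NS] := leqP S N; last first.
  rewrite leqNgt (leq_trans NS) ?leq_addl // andbF big1 // => x _.
  by rewrite leqNgt (leq_ltn_trans (leq_subr _ _) NS) mulr0.
(* For [x > N - S] the remaining size is below [S] and the inner sum is 0, so the range shrinks. *)
transitivity (C * \sum_(x < (N - S).+1) wt (kappa ord0) x * wt a (N - S - x)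
  * hahn1 (nu ord0) (kappa ord0) a (N - S)%:R x%:R
  * hahn1 (mu ord0) (kappa ord0) a (N - S)%:R x%:R).
  rewrite big_distrr (big_ord_widen N.+1 (fun x => C * (wt (kappa ord0) x * wt a (N - S - x)
  * hahn1 (nu ord0) (kappa ord0) a (N - S)%:R x%:R
  * hahn1 (mu ord0) (kappa ord0) a (N - S)%:R x%:R))) ?ltnS ?leq_subr //.
  rewrite [RHS]big_mkcond; apply: eq_bigr => x _ /=.
  have -> : (S <= N - x)%N = (x < (N - S).+1)%N by have := leq_ord x; lia.
  case: ifP => _; last by rewrite mulr0.
  by rewrite natrB // subnAC; ring.
rewrite hahn1_orthogonal // leq_subRL // addnC.
case: ifP => _; last by rewrite mulr0.
rewrite mulrA subnDA; congr (_ * wt _ _); last by rewrite subnAC.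
by rewrite [in RHS]big_ord_recl natrD -natr1 aE; ring.
Qed.

Lemma hahn_mass_gt0 {R : realType} d (kappa : 'I_d.+1 -> R) N :
  (forall i, -1 < kappa i) -> 0 < hahn_mass kappa N.
Proof. by move=> k1; apply: poch_gt0; have := sum_param_gt d kappa k1; lra. Qed.

Lemma hahn_ratio_gt0 {R : realType} d (kappa : 'I_d.+1 -> R) x :
  (forall i, -1 < kappa i) -> 0 < hahn_ratio kappa x.
Proof. by move=> k1; rewrite hahn_ratioE prodr_gt0 // => i _; apply: wt_gt0. Qed.

(** The bound |nu| <= N keeps (-N)_|nu| nonzero; the other factors are quotients of positive
    symbols. *)
Lemma hahn_const_neq0 {R : realType} d (kappa : 'I_d.+1 -> R) N (nu : 'I_d -> nat) :
  (forall i, -1 < kappa i) -> (\sum_i nu i <= N)%N -> hahn_const kappa N nu != 0.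
Proof.
move=> k1 nuN; rewrite mulf_neq0 //.
  rewrite mulf_neq0 ?invr_eq0 ?signr_eq0 // poch_oppn mulf_neq0 ?signr_eq0 //.
  by rewrite pnatr_eq0 -lt0n ffact_gt0.
apply/prodf_neq0 => j _; have ha := hahn_a_gt d kappa nu j k1.
have hk := k1 (widen_ord (leqnSn d) j).
by rewrite gt_eqF // divr_gt0 // poch_gt0 //; lra.
Qed.

Lemma hahn_ipE {R : realType} d (kappa : 'I_d.+1 -> R) N (nu mu : 'I_d -> nat) :
  hahn_ip kappa (fun x : multiindex d.+1 N => hahn kappa N nu x)
    (fun x : multiindex d.+1 N => hahn kappa N mu x)
  = N`!%:R / hahn_mass kappa N * (hahn_const kappa N nu * hahn_const kappa N mu)
    * simplex_sum N d.+1 N (fun x => (\prod_i wt (kappa i) (x i))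
        * hahn_prod kappa N nu x * hahn_prod kappa N mu x).
Proof.
rewrite /hahn_ip -simplex_sum_multiindex -[RHS]mulrA; congr (_ * _).
by rewrite big_distrr; apply: eq_bigr => x _; rewrite !hahnE hahn_ratioE /=; ring.
Qed.

Lemma hahn_B_gt0 {R : realType} d (kappa : 'I_d.+1 -> R) N (nu : 'I_d -> nat) :
  (forall i, -1 < kappa i) -> (\sum_i nu i <= N)%N -> 0 < hahn_B kappa N nu.
Proof.
move=> k1 nuN; rewrite /hahn_B hahn_ipE.
have [C C0 ->//] := simplex_sum_hahn_prod N d kappa nu k1.
have -> : [forall j, nu j == nu j] by apply/forallP.
rewrite nuN; have := hahn_const_neq0 d kappa N nu k1 nuN.
rewrite -sqrf_eq0 expr2 => c0.
rewrite mulr_gt0 //.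
  rewrite mulr_gt0 ?divr_gt0 ?hahn_mass_gt0 ?ltr0n ?fact_gt0 //.
  by rewrite lt0r c0 -expr2 sqr_ge0.
rewrite mulr_gt0 // wt_gt0 //; have := sum_param_gt d kappa k1.
by have := ler0n R (\sum_i nu i); lra.
Qed.

Lemma hahn_orthogonal {R : realType} d (kappa : 'I_d.+1 -> R) N (nu mu : 'I_d -> nat) :
  (forall i, -1 < kappa i) -> ~ nu =1 mu ->
  hahn_ip kappa (fun x : multiindex d.+1 N => hahn kappa N nu x)
    (fun x : multiindex d.+1 N => hahn kappa N mu x) = 0.
Proof.
move=> k1 numu; rewrite hahn_ipE.
have [C C0 ->//] := simplex_sum_hahn_prod N d kappa nu k1.
by case: forallP => [h|_]; [case: numu => j; apply/eqP | rewrite mulr0].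
Qed.

(** * The tight frame *)

Lemma component_inj k N (y z : multiindex k N) : y =1 z -> y = z.
Proof.
by move=> yz; apply/val_inj/eq_from_tnth => i; apply/val_inj/yz.
Qed.

Theorem theorem5p2 (R : realType) (d n m : nat) (kappa : 'I_d.+1 -> R)
    (e : 'I_(frame_dim d n) -> multiindex d n) :
  (1 <= d)%N -> (1 <= n)%N -> (n <= m)%N ->
  (forall i, -1 < kappa i) ->
  bijective e ->
  #|{: multiindex d.+1 m}| = 'C(m + d, d) /\
  tight_frame (fun alpha : multiindex d.+1 m => hahn_frame kappa e alpha).
Proof.
move=> _ _ nm k1 /bij_inj e_inj; split=> [|v]; first exact: card_multiindex.
pose ip i j := hahn_ip kappa (fun x : multiindex d.+1 m => hahn kappa m (e i) x)
    (fun x : multiindex d.+1 m => hahn kappa m (e j) x).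
pose c i := v 0 i / Num.sqrt (hahn_B kappa m (e i)).
(* This is the squared norm of the Hahn expansion with coefficients [c]: off-diagonal terms vanish
   by orthogonality, and the diagonal ones are c_i^2 B_i = v_i^2. *)
transitivity (\sum_i \sum_j c i * c j * ip i j).
  apply: eq_bigr => i _; rewrite (bigD1 i) //= big1 => [|j ji]; last first.
    rewrite /ip hahn_orthogonal ?mulr0 // => /component_inj/e_inj ij.
    by rewrite ij eqxx in ji.
  have B0 : 0 < hahn_B kappa m (e i) by rewrite hahn_B_gt0 ?sum_component.
  have s0 : Num.sqrt (hahn_B kappa m (e i)) != 0 by rewrite gt_eqF ?sqrtr_gt0.
  rewrite addr0 /c [ip i i](_ : _ = Num.sqrt (hahn_B kappa m (e i)) ^+ 2).
    by field.
  by rewrite sqr_sqrtr // ltW.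
transitivity (\sum_(alpha : multiindex d.+1 m) \sum_i \sum_j
   (m`!%:R / hahn_mass kappa m * hahn_ratio kappa alpha)
    * (c i * hahn kappa m (e i) alpha) * (c j * hahn kappa m (e j) alpha)).
  rewrite [RHS]exchange_big; apply: eq_bigr => i _ /=.
  rewrite [RHS]exchange_big; apply: eq_bigr => j _ /=.
  rewrite /ip /hahn_ip !big_distrr; apply: eq_bigr => alpha _ /=; ring.
apply: eq_bigr => alpha _.
(* [w] is the mass of the point [alpha]; being nonnegative, it is recovered by squaring the root in
   the frame vector. *)
set w := m`!%:R / _ * _.
have w0 : 0 <= w.
  by rewrite ltW // mulr_gt0 ?hahn_ratio_gt0 // divr_gt0 ?hahn_mass_gt0 ?ltr0n ?fact_gt0.
have -> : dot v (hahn_frame kappa e alpha)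
  = Num.sqrt w * \sum_i c i * hahn kappa m (e i) (alpha : multiindex d.+1 m).
  rewrite big_distrr; apply: eq_bigr => i _ /=.
  by rewrite !mxE /c -/w; ring.
rewrite exprMn sqr_sqrtr // expr2 big_distrlr big_distrr; apply: eq_bigr => i _.
by rewrite big_distrr; apply: eq_bigr => j _ /=; ring.
Qed.
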